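(* Let $A=U+XY^H\in\mathbb{C}^{n\times n}$ be a proper upper Hessenberg matrix, with $U$ unitary and $X,Y\in\mathbb{C}^{n\times k}$ of full rank ($k\le n$), let $N=n+k$, and let $\hat A=\hat U+\hat X\hat Y^H\in\mathbb{C}^{N\times N}$ be the (upper Hessenberg) embedding of $A$. Then $\hat A$ can be factorized as $$\hat A=L\cdot F\cdot R,$$ where - $L\in\mathbb{C}^{N\times N}$ is a proper unitary $k$-lower Hessenberg matrix; - $R=(r_{ij})\in\mathbb{C}^{N\times N}$ is a unitary $k$-upper Hessenberg matrix, and moreover the leading $n-1$ entries in its outermost diagonal, $r_{i+k,i}$ for $i=1,\dots,n-1$, are nonzero; - $F=Q+TZ^H$, where $Q=\begin{bmatrix} I_k & 0\\ 0& \hat Q\end{bmatrix}$ is a block diagonal unitary upper Hessenberg matrix with $\hat Q\in\mathbb{C}^{n\times n}$ proper upper Hessenberg, $T=\begin{bmatrix}T_k\\ 0_{n,k}\end{bmatrix}$ with $T_k\in\mathbb{C}^{k\times k}$ upper triangular, and $Z\in\mathbb{C}^{N\times k}$ has full rank. If in addition $A$ is nonsingular, then $R$ is proper.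
   Context: A matrix $H$ is $k$-upper Hessenberg if $h_{ij}=0$ whenever $i>j+k$, and $k$-lower Hessenberg if $h_{ij}=0$ whenever $j>i+k$; ''upper Hessenberg'' means $1$-upper Hessenberg. A $k$-upper (resp. $k$-lower) Hessenberg matrix of size $m$ is proper if its outermost entries are all nonzero, i.e. $h_{j+k,j}\ne 0$ (resp. $h_{j,j+k}\neq 0$) for $1\le j\le m-k$. For $k=1$ proper means unreduced. $M^H$ is the conjugate transpose. Embedding. Given $A=U+XY^H$ with $U\in\mathbb{C}^{n\times n}$ unitary and $X,Y\in\mathbb{C}^{n\times k}$ of full rank, take an economy-size QR decomposition $Y=Q_YR_Y$ ($Q_Y\in\mathbb{C}^{n\times k}$ with orthonormal columns, $R_Y\in\mathbb{C}^{k\times k}$ upper triangular), set $\tilde Y=Q_Y$, $\tilde X=XR_Y^H$, $B=U\tilde Y$, and define, with $N=n+k$, $$\hat U=\begin{bmatrix}U-U\tilde Y\tilde Y^H & B\\ \tilde Y^H & 0_k\end{bmatrix},\quad \hat X=\begin{bmatrix}\tilde X+B\\ -I_k\end{bmatrix},\quad \hat Y=\begin{bmatrix}\tilde Y\\ 0_k\end{bmatrix},\quad \hat A=\hat U+\hat X\hat Y^H=\begin{bmatrix}A & B\\ 0_{k,n}&0_k\end{bmatrix}.$$ Here $\hat U$ is unitary, and $\hat A$ is upper Hessenberg whenever $A$ is. *)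

(* Defs.v *)
From HB Require Import structures.
From mathcomp Require Import all_boot all_order all_algebra.
From mathcomp Require Import sesquilinear spectral reals.
From mathcomp.real_closed Require Import complex.

Set Implicit Arguments.
Unset Strict Implicit.
Unset Printing Implicit Defensive.

Import Order.TTheory GRing.Theory Num.Theory.
Local Open Scope ring_scope.
Local Open Scope sesquilinear_scope.

Section Hessenberg.
Variables (C : numClosedFieldType) (m k : nat).
Implicit Type H : 'M[C]_m.

(* The constraints only involve differences of indices, so they read the same
   with the 0-based indices of 'I_m as with 1-based ones. *)

Definition upper_hessenberg H : Prop :=
  forall i j : 'I_m, (j + k < i)%N -> H i j = 0.

Definition lower_hessenberg H : Prop :=
  forall i j : 'I_m, (i + k < j)%N -> H i j = 0.

Definition proper_upper_hessenberg H : Prop :=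
  upper_hessenberg H /\
  (forall i j : 'I_m, (i = j + k :> nat)%N -> H i j != 0).

Definition proper_lower_hessenberg H : Prop :=
  lower_hessenberg H /\
  (forall i j : 'I_m, (j = i + k :> nat)%N -> H i j != 0).

End Hessenberg.

Section Embedding.
Variables (C : numClosedFieldType) (n k : nat).
Implicit Types (U : 'M[C]_n) (X Y Qy : 'M[C]_(n, k)) (Ry : 'M[C]_k).

(* [is_trig_mx] is lower triangularity in the library, hence the transpose. *)
Definition upper_triangular (p : nat) (M : 'M[C]_p) : bool := is_trig_mx M^T.

Definition economy_QR Y Qy Ry : Prop :=
  [/\ Y = Qy *m Ry, Qy^t* *m Qy = 1%:M & upper_triangular Ry].

(* Since the QR factors of Y are not unique, the embedding takes them as
   arguments: below, Qy and Ry stand for a pair with [economy_QR Y Qy Ry],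
   and the matrix B of the embedding is U *m Qy. *)

Definition embU U Qy : 'M[C]_(n + k) :=
  block_mx (U - U *m Qy *m Qy^t*) (U *m Qy)
           (Qy^t*)                0.

Definition embX U X Qy Ry : 'M[C]_(n + k, k) :=
  col_mx (X *m Ry^t* + U *m Qy) (- 1%:M).

Definition embY Qy : 'M[C]_(n + k, k) := col_mx Qy 0.

Definition embA U X Qy Ry : 'M[C]_(n + k) :=
  embU U Qy + embX U X Qy Ry *m (embY Qy)^t*.

(* diag(I_k, Qh) and [Tk; 0] naturally have sizes indexed by k + n; they are
   transported along k + n = n + k to the size of the embedding. *)

Definition factorQ (Qh : 'M[C]_n) : 'M[C]_(n + k) :=
  castmx (addnC k n, addnC k n) (block_mx 1%:M 0 0 Qh).

Definition factorT (Tk : 'M[C]_k) : 'M[C]_(n + k, k) :=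
  castmx (addnC k n, erefl k) (col_mx Tk 0).

End Embedding.

(* Main.v *)
(** With [X^ = [X1; -I]] the second factor of the embedding, the columns of
    [W = [I; X1^H]] span the orthogonal complement of the range of [X^].  A QR
    factorization [X^ = L1 Tk] and a Cholesky factorization
    [G G^H = (W^H W)^-1] with [G] lower triangular give [L = [L1, W G]], whose
    upper right block is [G], so that [L] is proper k-lower Hessenberg.  The
    last [n] rows of [L^H] kill [X^], hence they map the embedding of [U] to
    [G^H [A, B]].  A QR factorization [G^H A = Qh S] of a proper Hessenberg
    matrix has [Qh] proper Hessenberg and [S] with nonzero diagonal, except
    possibly for the last entry; [Qh] and [S] are the corresponding blocks of
    [Q] and of [R = Q^H L^H U^]. *)
Require Import Defs.
From mathcomp Require Import all_boot all_order all_algebra.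
From mathcomp Require Import sesquilinear spectral reals.
From mathcomp.real_closed Require Import complex.

Set Implicit Arguments.
Unset Strict Implicit.
Unset Printing Implicit Defensive.

Import Order.TTheory GRing.Theory Num.Theory.
Local Open Scope ring_scope.
Local Open Scope sesquilinear_scope.

(** * Index casts between [k + n] and [n + k] *)

Lemma mulmx_cast (V : pzRingType) (m n p m' n' p' : nat) (em : m = m')
    (en : n = n') (ep : p = p') (A : 'M[V]_(m, n)) (B : 'M[V]_(n, p)) :
  castmx (em, en) A *m castmx (en, ep) B = castmx (em, ep) (A *m B).
Proof. by case: m' / em; case: n' / en; case: p' / ep. Qed.

(** With rows split as [k + n] and columns as [n + k], the entries on or below the [k]-th
    subdiagonal all fall in the lower left [n] by [n] block, on or below its diagonal. Being
    [k]-Hessenberg thus becomes triangularity of that block. *)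
Lemma lower_corner (n k : nat) (e : (k + n = n + k)%N) (i j : 'I_(n + k)) :
  (j + k <= i)%N ->
  exists i' j' : 'I_n,
    [/\ cast_ord (esym e) i = rshift k i', j = lshift k j',
        i = i' + k :> nat & j = j' :> nat]%N.
Proof.
case: (split_ordP (cast_ord (esym e) i)) => i' ei; have /= vi := congr1 val ei.
  by rewrite leqNgt vi ltn_addl.
case: (split_ordP j) => j' ej; have /= vj := congr1 val ej; last first.
  by rewrite vi vj leqNgt [X in (_ < X)%N]addnC ltn_add2l ltn_addr.
by exists i', j'; split=> //; rewrite vi addnC.
Qed.

(** * Triangular factors and Hessenberg matrices *)

Section Triangular.
Variable C : numClosedFieldType.

Lemma trmxC_mul (m n p : nat) (A : 'M[C]_(m, n)) (B : 'M[C]_(n, p)) :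
  (A *m B)^t* = B^t* *m A^t*.
Proof. by rewrite trmx_mul map_mxM. Qed.

Lemma trmxC1 (n : nat) : (1%:M : 'M[C]_n)^t* = 1%:M.
Proof. by rewrite trmx1 map_mx1. Qed.

Lemma castmx_unitary (m n m' n' : nat) (em : m = m') (en : n = n')
    (A : 'M[C]_(m, n)) :
  (castmx (em, en) A \is unitarymx) = (A \is unitarymx).
Proof. by case: m' / em; case: n' / en. Qed.

Lemma eq_trmxC_unitary (m n : nat) (A : 'M[C]_(m, n)) :
  m = n -> (A^t* \is unitarymx) = (A \is unitarymx).
Proof. by move=> e; case: n / e A => A; exact: trmxC_unitary. Qed.

Lemma upper_triangularP (n : nat) (A : 'M[C]_n) :
  reflect (forall i j : 'I_n, (j < i)%N -> A i j = 0) (upper_triangular A).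
Proof.
by apply: (iffP is_trig_mxP) => h i j /h; rewrite mxE.
Qed.

Lemma trmxC_trig (n : nat) (A : 'M[C]_n) :
  is_trig_mx A -> upper_triangular (A^t*).
Proof.
by move=> /is_trig_mxP tA; apply/upper_triangularP => i j /tA h;
  rewrite !mxE h conjC0.
Qed.

Lemma trig_unit_diag (n : nat) (A : 'M[C]_n) (i : 'I_n) :
  is_trig_mx A -> A \in unitmx -> A i i != 0.
Proof.
move=> tA; rewrite unitmxE det_trig // unitfE => /prodf_neq0; exact.
Qed.

Lemma upper_triangular_unit_diag (n : nat) (A : 'M[C]_n) (i : 'I_n) :
  upper_triangular A -> A \in unitmx -> A i i != 0.
Proof.
by move=> tA uA; have := @trig_unit_diag _ A^T i tA; rewrite mxE unitmx_tr; exact.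
Qed.

(** Row [i] of [A] lies in the span of the first [i + 1] rows of its Gram-Schmidt basis [Q], hence
    is orthogonal to the later ones: [A *m Q^t*] is lower triangular. *)
Lemma LQ_factorization (m n : nat) (A : 'M[C]_(m, n)) : (m <= n)%N ->
  exists (T : 'M[C]_m) (Q : 'M[C]_(m, n)),
    [/\ A = T *m Q, is_trig_mx T & Q \is unitarymx].
Proof.
move=> le_mn; have uQ : schmidt A \is unitarymx := schmidt_unitarymx A le_mn.
have [sA rsA] := (schmidt_sub A, row_schmidt_sub A).
move: (schmidt A) uQ sA rsA => Q uQ /submxP[D eA] rsQ.
have QQ := unitarymxP uQ; exists (A *m Q^t*), Q; split=> //.
  by rewrite eA -!mulmxA [Q *m _]mulmxA QQ mul1mx.
apply/is_trig_mxP => i j lt_ij.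
have : (row i A <= kermx (col j (Q^t*)))%MS.
  apply: submx_trans (rsQ i) _.
  apply/sumsmx_subP => l le_li; rewrite genmxE; apply/sub_kermxP.
  rewrite colE mulmxA -row_mul QQ row1 mul_delta_mx_0 //.
  by rewrite -val_eqE neq_ltn (leq_ltn_trans le_li lt_ij).
move=> /sub_kermxP; rewrite colE mulmxA -row_mul -colE => /matrixP/(_ 0 0).
by rewrite !mxE.
Qed.

Lemma QR_factorization (m n : nat) (A : 'M[C]_(n, m)) : (m <= n)%N ->
  exists (Q : 'M[C]_(n, m)) (T : 'M[C]_m),
    [/\ A = Q *m T, Q^t* *m Q = 1%:M & upper_triangular T].
Proof.
move=> le_mn; have [T [Q [eA tT /unitarymxP uQ]]] := LQ_factorization (A^t*) le_mn.
exists (Q^t*), (T^t*); rewrite trmxCK -trmxC_mul -eA trmxCK; split=> //.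
exact: trmxC_trig.
Qed.

(** [P *m Q] is a left inverse of the square factor [T]. *)
Lemma QR_unit (m n : nat) (A Q : 'M[C]_(n, m)) (T : 'M[C]_m)
    (P : 'M[C]_(m, n)) : A = Q *m T -> P *m A = 1%:M -> T \in unitmx.
Proof. by move=> ->; rewrite mulmxA => /mulmx1_unit[]. Qed.

Lemma upper_triangular_mul_hessenberg (n : nat) (T H : 'M[C]_n) :
  upper_triangular T -> T \in unitmx -> proper_upper_hessenberg 1 H ->
  proper_upper_hessenberg 1 (T *m H).
Proof.
move=> tT uT [hH pH]; have /upper_triangularP T0 := tT.
split=> i j eij.
  rewrite mxE big1 // => l _; have [/T0->|le_il] := ltnP l i; first by rewrite mul0r.
  by rewrite hH ?mulr0 // (leq_trans eij).
rewrite mxE (bigD1 i) //= big1 ?addr0.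
  by rewrite mulf_neq0 ?upper_triangular_unit_diag // pH.
move=> l ne_li; have [/T0->|le_il] := ltnP l i; first by rewrite mul0r.
by rewrite hH ?mulr0 // -eij ltn_neqAle eq_sym ne_li.
Qed.

(** Since [M] may be singular, [Q] cannot be obtained as M S^-1. Instead the columns are treated in
    turn: if the earlier columns of [Q] are Hessenberg, then below the diagonal column [j] of [M] is
    [S j j] times that of [Q]. The nonzero subdiagonal entry of [M] forces [S j j != 0], which
    passes the zero pattern on to column [j] of [Q]. The last column has no subdiagonal entry, so
    its [S j j] may vanish. *)
Lemma hessenberg_QR (n : nat) (M Q S : 'M[C]_n) :
  M = Q *m S -> upper_triangular S -> proper_upper_hessenberg 1 M ->
  proper_upper_hessenberg 1 Q /\ (forall j : 'I_n, (j.+1 < n)%N -> S j j != 0).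
Proof.
move=> eM /upper_triangularP tS [hM pM].
have step (j : 'I_n) : (forall l : 'I_n, (l < j)%N ->
     forall i : 'I_n, (l + 1 < i)%N -> Q i l = 0) ->
    forall i : 'I_n, (j < i)%N -> M i j = Q i j * S j j.
  move=> IH i lt_ji; rewrite eM mxE (bigD1 j) //= big1 ?addr0 // => l.
  rewrite -val_eqE /= neq_ltn => /orP[lt_lj|/tS->]; last by rewrite mulr0.
  by rewrite (IH l) ?mul0r // addn1 (leq_ltn_trans _ lt_ji).
have diag (j : 'I_n) : (forall l : 'I_n, (l < j)%N ->
     forall i : 'I_n, (l + 1 < i)%N -> Q i l = 0) ->
    (j.+1 < n)%N -> S j j != 0.
  move=> IH lt_jn; have := pM (Ordinal lt_jn) j; rewrite addn1 => /(_ erefl).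
  by rewrite (step j IH) //= mulf_eq0 negb_or => /andP[].
have hQ m : forall l : 'I_n, (l < m)%N ->
     forall i : 'I_n, (l + 1 < i)%N -> Q i l = 0.
  elim: m => // m IHm l lt_lm i lt_li.
  have IH (l' : 'I_n) : (l' < l)%N ->
     forall i : 'I_n, (l' + 1 < i)%N -> Q i l' = 0.
    by move=> lt_l'l; apply: IHm; apply: leq_trans lt_l'l _.
  have lt_li' : (l < i)%N by apply: leq_trans lt_li; rewrite addn1.
  have := hM _ _ lt_li; rewrite (step l IH) // => /eqP.
  rewrite mulf_eq0 (negPf (diag l IH _)) ?orbF; first by move/eqP.
  (* A row [i] with [l + 1 < i] exists only if [l.+1 < n], as [diag] requires. *)
  by move: lt_li; rewrite addn1 => /ltn_trans; apply.
split=> [|j]; last exact/diag/hQ.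
split=> [i j lt_ji|i j eij]; first exact: hQ (ltnSn j) _ lt_ji.
have := pM i j eij; rewrite (step j (hQ j)) ?eij ?addn1 //.
by rewrite mulf_eq0 negb_or => /andP[].
Qed.

End Triangular.

(** * The embedding and the left unitary factor *)

Lemma embU_unitary (C : numClosedFieldType) (n k : nat) (U : 'M[C]_n)
    (Qy : 'M[C]_(n, k)) :
  U \is unitarymx -> Qy^t* *m Qy = 1%:M -> embU U Qy \is unitarymx.
Proof.
move=> /unitarymxP uU oQ; apply/unitarymxP.
(* [P] projects orthogonally onto the complement of the range of [Qy]. The upper left block of the
   Gram matrix is U (P + Qy Qy^H) U^H = I, and [P *m Qy = 0] kills the off-diagonal blocks. *)
pose P : 'M[C]_n := 1%:M - Qy *m Qy^t*.
have Pt : P^t* = P by rewrite [P^T]linearB map_mxB trmxC_mul trmxCK trmxC1.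
have PQ : P *m Qy = 0 by rewrite mulmxBl mul1mx -mulmxA oQ mulmx1 subrr.
have PP : P *m P = P by rewrite {2}/P mulmxBr mulmx1 mulmxA PQ mul0mx subr0.
have -> : embU U Qy = block_mx (U *m P) (U *m Qy) (Qy^t*) 0.
  by rewrite /P mulmxBr mulmx1 mulmxA.
have QP : Qy^t* *m P = 0 by rewrite -Pt -trmxC_mul PQ trmx0 map_mx0.
rewrite tr_block_mx map_block_mx mulmx_block trmxCK !trmxC_mul Pt trmx0 map_mx0.
rewrite !mulmx0 !mul0mx !addr0 oQ -!mulmxA PQ (mulmxA P P) PP (mulmxA (Qy^t*) P) QP.
rewrite mul0mx mulmx0 !mulmxA -mulmxDl -mulmxA -mulmxDr subrK mulmx1 uU.
by rewrite -scalar_mx_block.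
Qed.

Lemma embA_block (C : numClosedFieldType) (n k : nat) (U : 'M[C]_n)
    (X Y Qy : 'M[C]_(n, k)) (Ry : 'M[C]_k) : Y = Qy *m Ry ->
  embA U X Qy Ry = block_mx (U + X *m Y^t*) (U *m Qy) 0 0.
Proof.
move=> ->; rewrite /embA /embU /embX /embY tr_col_mx map_row_mx mul_col_row.
rewrite trmx0 map_mx0 !mulmx0 add_block_mx !addr0 mulNmx mul1mx subrr.
by rewrite mulmxDl trmxC_mul mulmxA addrACA addNr addr0.
Qed.

Lemma unitary_completion (C : numClosedFieldType) (n k : nat)
    (X : 'M[C]_(n, k)) :
  exists (Q : 'M[C]_(n + k, k)) (T : 'M[C]_k) (G : 'M[C]_n),
    let L := row_mx Q (col_mx G (X^t* *m G)) in
    [/\ col_mx X (- 1%:M) = Q *m T, upper_triangular T, is_trig_mx G,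
        G \in unitmx & L^t* *m L = 1%:M].
Proof.
pose W : 'M[C]_(n + k, n) := col_mx 1%:M (X^t*).
have [Q [T [eX oQ tT]]] := QR_factorization (col_mx X (- 1%:M)) (leq_addl n k).
have [W0 [T0 [eW oW _]]] := QR_factorization W (leq_addr k n).
have uT : T \in unitmx.
  (* The block [- 1%:M] provides a left inverse. *)
  apply: (QR_unit (P := row_mx 0 (- 1%:M)) eX).
  by rewrite mul_row_col mul0mx add0r mulmxN mulNmx mulmx1 opprK.
have uT0 : T0 \in unitmx.
  by apply: (QR_unit (P := row_mx 1%:M 0) eW); rewrite mul_row_col mul0mx mulmx1 addr0.
(* This replaces Cholesky: W^H W = T0^H T0, so T0^-1 = G B with [B] unitary gives G G^H = (W^H
   W)^-1, and W G = W0 B^H has orthonormal columns. *)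
have [G [B [eT0 tG uB]]] := LQ_factorization (invmx T0) (leqnn n).
have uG : G \in unitmx.
  have : invmx T0 \in unitmx by rewrite unitmx_inv.
  by rewrite eT0 unitmx_mul => /andP[].
have eWG : col_mx G (X^t* *m G) = W0 *m B^t*.
  have -> : col_mx G (X^t* *m G) = W *m G by rewrite mul_col_mx mul1mx.
  by rewrite -[G](mulmxtVK _ uB) -eT0 eW -!mulmxA (mulmxA T0) mulmxV // mul1mx.
exists Q, T, G; split=> //.
(* Invertibility of [T] lets [Q] inherit from [X; -I] its orthogonality to the range of [W]. *)
have orth : (col_mx G (X^t* *m G))^t* *m Q = 0.
  rewrite -[Q](mulmxK uT) -eX mulmxA tr_col_mx map_row_mx mul_row_col.
  by rewrite trmxC_mul trmxCK mulmxN mulmx1 subrr mul0mx.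
rewrite tr_row_mx map_col_mx mul_col_row oQ orth.
have -> : Q^t* *m col_mx G (X^t* *m G) = 0.
  by rewrite -[LHS]trmxCK trmxC_mul trmxCK orth trmx0 map_mx0.
rewrite eWG trmxC_mul trmxCK -mulmxA (mulmxA _ W0) oW mul1mx (unitarymxP uB).
by rewrite -scalar_mx_block.
Qed.

(** * Assembling the three factors *)

Theorem theorem2 (R : realType) (n k : nat)
    (A U : 'M[complex R]_n) (X Y Qy : 'M[complex R]_(n, k))
    (Ry : 'M[complex R]_k)
    (hkn : (k <= n)%N)
    (hA : A = U + X *m Y^t*)
    (hAH : proper_upper_hessenberg 1 A)
    (hU : U \is unitarymx)
    (hX : \rank X = k)
    (hY : \rank Y = k)
    (hQR : economy_QR Y Qy Ry) :
  exists (L F Rm : 'M[complex R]_(n + k)),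
    [/\ embA U X Qy Ry = L *m F *m Rm,
        L \is unitarymx /\ proper_lower_hessenberg k L,
        [/\ Rm \is unitarymx, upper_hessenberg k Rm
          & forall i j : 'I_(n + k),
              (j.+1 < n)%N -> (i = j + k :> nat)%N -> Rm i j != 0],
        exists (Qh : 'M[complex R]_n) (Tk : 'M[complex R]_k)
               (Z : 'M[complex R]_(n + k, k)),
          [/\ F = factorQ k Qh + factorT n Tk *m Z^t*,
              factorQ k Qh \is unitarymx /\ upper_hessenberg 1 (factorQ k Qh),
              proper_upper_hessenberg 1 Qh,
              upper_triangular Tk
            & \rank Z = k]
      & A \in unitmx -> proper_upper_hessenberg k Rm].
Proof.
case: hQR => eY oQy tRy.
pose X1 := X *m Ry^t* + U *m Qy.
have [Q1 [Tk [G [eX tTk tG uG oL]]]] := unitary_completion X1.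
set L' := row_mx _ _ in oL.
have hGA : proper_upper_hessenberg 1 (G^t* *m A).
  apply: upper_triangular_mul_hessenberg => //; first exact: trmxC_trig.
  by rewrite map_unitmx unitmx_tr.
have [Qh [S [eS oQh tS]]] := QR_factorization (G^t* *m A) (leqnn n).
have [hQh dS] := hessenberg_QR eS tS hGA.
have uQh : Qh \is unitarymx by rewrite -trmxC_unitary; apply/unitarymxP; rewrite trmxCK.
pose E := embU U Qy; have uE : E \is unitarymx by exact: embU_unitary.
pose V := L'^t* *m E.
pose D : 'M[complex R]_(k + n) := block_mx 1%:M 0 0 Qh.
have uD : D \is unitarymx.
  apply/unitarymxP; rewrite tr_block_mx map_block_mx mulmx_block trmxC1 !trmx0.
  rewrite !map_mx0 !mul0mx !mulmx0 !addr0 !add0r mulmx1 (unitarymxP uQh).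
  by rewrite -scalar_mx_block.
pose R' := D^t* *m V.
pose e := addnC k n.
(* Only the index between consecutive factors splits as [k + n]; the outer ones stay [n + k]. Hence
   the cast acts on the columns of [L'] and on the rows of [R']. *)
pose L := castmx (erefl _, e) L'.
pose Rm := castmx (e, erefl _) R'.
have eL i j : L i j = L' i (cast_ord (esym e) j) by rewrite castmxE /= cast_ord_id.
have eR i j : Rm i j = R' (cast_ord (esym e) i) j by rewrite castmxE /= cast_ord_id.
have uL't : L'^t* \is unitarymx by apply/unitarymxP; rewrite trmxCK.
have uL' : L' \is unitarymx by rewrite -eq_trmxC_unitary // addnC.
have uR : Rm \is unitarymx.
  by rewrite castmx_unitary !mul_unitarymx // trmxC_unitary.
have dV : dsubmx V = row_mx (G^t* *m A) (G^t* *m (U *m Qy)).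
  rewrite /V tr_row_mx map_col_mx mul_col_mx col_mxKd tr_col_mx map_row_mx.
  rewrite trmxC_mul trmxCK; set H := row_mx _ _.
  (* The rows [H] annihilate [embX], so on them [E] may be replaced by the embedding of [A], whose
     last block row is zero. *)
  have HX : H *m embX U X Qy Ry = 0.
    by rewrite mul_row_col -/X1 mulmxN mulmx1 subrr.
  have : H *m embA U X Qy Ry = H *m E by rewrite mulmxDr mulmxA HX mul0mx addr0.
  by rewrite (embA_block _ _ eY) -hA mul_row_block !mulmx0 !addr0 => <-.
have R'E (i : 'I_n) (j : 'I_n) : R' (rshift k i) (lshift k j) = S i j.
  rewrite /R' -[V]vsubmxK dV eS tr_block_mx map_block_mx !trmx0 !map_mx0 mul_block_col.
  by rewrite !mul0mx add0r mul_mx_row mulmxA oQh mul1mx col_mxEd row_mxEl.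
have RmE (i j : 'I_(n + k)) : (j + k <= i)%N ->
    exists i' j' : 'I_n, [/\ i = i' + k :> nat, j = j' :> nat & Rm i j = S i' j']%N.
  move/(lower_corner e) => [i' [j' [ei ej vi vj]]].
  by exists i', j'; rewrite eR ei {2}ej R'E.
have LE (i j : 'I_(n + k)) : (i + k <= j)%N ->
    exists i' j' : 'I_n, [/\ i = i' :> nat, j = j' + k :> nat & L i j = G i' j']%N.
  move/(lower_corner e) => [j' [i' [ej ei vj vi]]].
  by exists i', j'; rewrite eL ej {2}ei row_mxEr col_mxEu.
(* With Z = Rm Y^, unitarity of [Rm] gives Z^H Rm = Y^^H, while L T = X^; so L T Z^H Rm is the
   low-rank term of the embedding. *)
exists L, (factorQ k Qh + factorT n Tk *m (Rm *m embY Qy)^t*), Rm.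
split.
- rewrite mulmxDr mulmxDl -mulmxA /factorQ mulmx_cast -/D /R' mulmxA.
  rewrite (unitarymxP uD) mul1mx mulmx_cast castmx_id mulmxA (unitarymxP uL') mul1mx.
  rewrite /factorT mulmxA mulmx_cast castmx_id mul_row_col mulmx0 addr0 -eX.
  by rewrite trmxC_mul -!mulmxA (mulmx1C (unitarymxP uR)) mulmx1.
- split; first by rewrite castmx_unitary.
  split=> i j ij.
    have [i' [j' [ei ej ->]]] := LE i j (ltnW ij).
    by move/is_trig_mxP: tG; apply; move: ij; rewrite ei ej ltn_add2r.
  have [i' [j' [ei ej ->]]] := LE i j (eq_leq (esym ij)).
  have -> : i' = j' by apply: val_inj; apply: (@addIn k); rewrite /= -ei -ej.
  exact: trig_unit_diag.
- split=> // i j; last first.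
    move=> lt_jn eij; have [i' [j' [ei ej ->]]] := RmE i j (eq_leq (esym eij)).
    have -> : i' = j' by apply: val_inj; apply: (@addIn k); rewrite /= -ei -ej.
    by apply: dS; rewrite -ej.
  move=> ij; have [i' [j' [ei ej ->]]] := RmE i j (ltnW ij).
  by move/upper_triangularP: tS; apply; move: ij; rewrite ei ej ltn_add2r.
- exists Qh, Tk, (Rm *m embY Qy); split=> //; last first.
    (* [Rm] is invertible, and [embY Qy] has orthonormal columns because [Qy] has. *)
    rewrite eqmxMfull ?row_full_unit ?unitarymx_unit //.
    rewrite -mxrank_tr -(mxrank_map Num.conj) mxrank_unitary //.
    apply/unitarymxP; rewrite trmxCK tr_col_mx map_row_mx mul_row_col.
    by rewrite mulmx0 addr0.
  split; first by rewrite castmx_unitary.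
  move=> i j lt_ji; rewrite castmxE /=.
  case: (split_ordP (cast_ord (esym e) i)) => i' ei; have /= vi := congr1 val ei;
    case: (split_ordP (cast_ord (esym e) j)) => j' ej; have /= vj := congr1 val ej;
    rewrite ei ej ?block_mxEul ?block_mxEur ?block_mxEdl ?block_mxEdr ?mxE //.
    by rewrite -val_eqE /= -vi -vj gtn_eqF // (leq_trans _ lt_ji) // ltnS leq_addr.
  by apply: hQh.1; move: lt_ji; rewrite vi vj -addnA ltn_add2l.
(* Only the last diagonal entry of [S] could still vanish; invertibility of G^H A = Qh S excludes
   this. *)
- move=> uA; have uS : S \in unitmx.
    have : G^t* *m A \in unitmx by rewrite unitmx_mul uA map_unitmx unitmx_tr uG.
    by rewrite eS unitmx_mul => /andP[].
  split=> i j ij.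
    have [i' [j' [ei ej ->]]] := RmE i j (ltnW ij).
    by move/upper_triangularP: tS; apply; move: ij; rewrite ei ej ltn_add2r.
  have [i' [j' [ei ej ->]]] := RmE i j (eq_leq (esym ij)).
  have -> : i' = j' by apply: val_inj; apply: (@addIn k); rewrite /= -ei -ej.
  exact: upper_triangular_unit_diag.
Qed.
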